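(* Let $U:\mathbb{Z}\to\mathbb{Q}$ be a linear recurrence sequence, let $a\in\mathbb{Q}$, and let $p$ be a regular prime for $U$. Assume that there exists a sequence of integers $(n_k)$ such that $\nu_p(U(n_k))\to+\infty$ and $\nu_p(n_k-a)\to+\infty$. Then $a$ is a twisted rational zero of $U$.
   Context: A $\mathbb{Q}$-valued linear recurrence sequence (LRS) is a map $U:\mathbb{Z}\to\mathbb{Q}$ with $U(n+m)=a_{m-1}U(n+m-1)+\dots+a_0U(n)$ for all $n\in\mathbb{Z}$, with $a_i\in\mathbb{Q}$, $a_0\ne0$, $m$ minimal. Let $\lambda_1,\dots,\lambda_s\in\overline{\mathbb{Q}}$ be the distinct roots of $X^m-a_{m-1}X^{m-1}-\dots-a_0$; then $U(n)=f_1(n)\lambda_1^n+\dots+f_s(n)\lambda_s^n$ with nonzero polynomials $f_i$ (Binet expansion). For $a=k/\ell\in\mathbb{Q}$ ($\gcd(k,\ell)=1$, $\ell>0$), a determination of the rational power $\lambda_i^a$ means $\mu^k$ for some $\mu\in\overline{\mathbb{Q}}$ with $\mu^\ell=\lambda_i$ (chosen independently for each $i$). The rational number $a$ is a twisted rational zero (TRZ) of $U$ if for some determinations of $\lambda_1^a,\dots,\lambda_s^a$ and some roots of unity $\xi_1,\dots,\xi_s$ we have $\xi_1f_1(a)\lambda_1^a+\dots+\xi_sf_s(a)\lambda_s^a=0$. A prime $p$ is regular for $U$ if $p$ divides neither the denominators of $a_0,\dots,a_{m-1}$ nor the numerator of $a_0$. $\nu_p$ is the $p$-adic valuation on $\mathbb{Q}$,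 $\nu_p(0)=+\infty$. *)

(* Defs.v *)
(* The field of algebraic numbers is algC throughout. *)
From HB Require Import structures.
From mathcomp Require Import all_boot all_order all_algebra all_field.
From mathcomp Require Import constructive_ereal.
Set Implicit Arguments.
Unset Strict Implicit.
Unset Printing Implicit Defensive.
Import Order.TTheory GRing.Theory Num.Theory.
Local Open Scope ring_scope.

Definition recurrence (U : int -> rat) (m : nat) (c : 'I_m -> rat) : Prop :=
  (forall i : 'I_m, i = 0%N :> nat -> c i != 0) /\
  (forall n : int, U (n + m%:Z) = \sum_(i < m) c i * U (n + i%:Z)).

(* The order and the coefficients are determined by the sequence, since the
   order is minimal. Order 0 is allowed: it is the order of the zero sequence,
   whose characteristic polynomial is 1 and whose Binet expansion is empty. *)
Record lrs := LRS {
  lrs_val :> int -> rat;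
  lrs_order : nat;
  lrs_coef : 'I_lrs_order -> rat;
  lrs_rec : recurrence lrs_val lrs_coef;
  lrs_min : forall (m : nat) (c : 'I_m -> rat),
    recurrence lrs_val c -> (lrs_order <= m)%N
}.

Definition lrs_charpoly (U : lrs) : {poly rat} :=
  'X^(lrs_order U) - \sum_(i < lrs_order U) lrs_coef i *: 'X^i.

(* Only one such family (up to reindexing) exists for a given U. *)
Definition binet_expansion (U : lrs) (s : nat)
    (lam : 'I_s -> algC) (f : 'I_s -> {poly algC}) : Prop :=
  [/\ injective lam,
      (forall z : algC,
         root (map_poly ratr (lrs_charpoly U)) z <-> exists i, lam i = z),
      (forall i, f i != 0)
    & (forall n : int,
         ratr (U n) = \sum_(i < s) (f i).[n%:~R] * lam i ^ n)].

(* denq a > 0 and numq a, denq a are coprime. *)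
Definition determination (z : algC) (a : rat) (w : algC) : Prop :=
  exists2 mu : algC, mu ^ denq a = z & w = mu ^ numq a.

Definition root_of_unity (z : algC) : Prop :=
  exists2 k : nat, (0 < k)%N & z ^+ k = 1.

Definition twisted_rational_zero (U : lrs) (a : rat) : Prop :=
  exists (s : nat) (lam : 'I_s -> algC) (f : 'I_s -> {poly algC}),
    binet_expansion U lam f /\
    exists w xi : 'I_s -> algC,
      [/\ (forall i, determination (lam i) a (w i)),
          (forall i, root_of_unity (xi i))
        & \sum_(i < s) xi i * (f i).[ratr a] * w i = 0].

Definition regular_prime (U : lrs) (p : nat) : Prop :=
  [/\ prime p,
      (forall i : 'I_(lrs_order U), ~~ (p %| `|denq (lrs_coef i)|)%N)
    & (forall i : 'I_(lrs_order U), i = 0%N :> nat ->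
         ~~ (p %| `|numq (lrs_coef i)|)%N)].

Definition padic_val (p : nat) (x : rat) : \bar int :=
  if x == 0 then +oo%E
  else ((logn p `|numq x|)%:Z - (logn p `|denq x|)%:Z)%:E.

Definition tends_to_pinfty (v : nat -> \bar int) : Prop :=
  forall M : int, exists K : nat,
    forall k : nat, (K <= k)%N -> (M%:E <= v k)%E.

(* Main.v *)
(* Let [O] be the integral closure of [Z_(p)] in the algebraic numbers. By
   regularity the roots [lam i] are units of [O], and by pigeonhole
   [lam i ^ N = 1] modulo [p] for some [N > 0]; hence [lam i ^ (N * e)] tends to
   [1] as [e] tends to [0] [p]-adically. With [a = num / den], [L = den * N] and
   [w i] a determination of [lam i ^ a], the [L]-th powers of [lam i ^ n k] and of
   [w i] thus become congruent modulo every power of [p], so that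
   [lam i ^ n k] approaches [w i] up to an [L]-th root of unity. In place of a
   choice of a prime above [p] and of a subsequence, one forms the product of the
   sums of [xi i * f i (a) * w i] over all tuples [xi] of [L]-th roots of unity:
   it is divisible in [O] by every power of [p] (up to a fixed denominator), hence
   zero, and one of its factors vanishes.

   For the Binet expansion, the nonvanishing of the [f i] uses minimality of the
   order: were [f i] zero, [U] would satisfy a shorter recurrence over the
   algebraic numbers, and applying a [rat]-linear form to its coefficients would
   give a shorter one over [rat]. *)
Require Import Defs.
From HB Require Import structures.
From mathcomp Require Import all_boot all_order all_algebra all_field.
From mathcomp Require Import constructive_ereal.
From mathcomp Require Import ring zify.
Set Implicit Arguments.
Unset Strict Implicit.
Unset Printing Implicit Defensive.
Import Order.TTheory GRing.Theory Num.Theory.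
Local Open Scope ring_scope.

(** * Exponential polynomials and the Binet expansion *)

Lemma coef_Xadd1_exp (R : comNzRingType) n j :
  (('X + 1 : {poly R}) ^+ n)`_j = 'C(n, j)%:R.
Proof.
rewrite exprD1n coef_sum.
under eq_bigr do rewrite coefMn coefXn.
case: (ltnP j n.+1) => hj.
  rewrite (bigD1 (Ordinal hj)) //= eqxx big1 ?addr0 // => i ne.
  by rewrite (_ : (j == i :> nat) = false) ?mul0rn // eq_sym; apply/negbTE.
rewrite big1 ?bin_small // => i _.
by rewrite (_ : (j == i :> nat) = false) ?mul0rn // gtn_eqF // (leq_trans (ltn_ord i)).
Qed.

Section LinearRecurrences.

Variable K : numFieldType.
Implicit Types (q h f : {poly K}) (V W : int -> K) (S : seq K).

(** With such an [h], the sequence [h.[n] * y ^ n] solves [W (n + 1) - z * W n = f.[n] * y ^ n].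
    Each induction step cancels the top coefficient of [f] by the image of a monomial; the case
    [y = z] divides by [m.+1], hence characteristic 0. *)
Lemma twisted_difference_surjective (y z : K) f : y != 0 ->
  exists h, y *: (h \Po ('X + 1)) - z *: h = f.
Proof.
move=> y0; move: {2}(size f) (leqnn (size f)) => m.
elim: m f => [|m IH] f sf.
  exists 0; rewrite comp_poly0 !scaler0 subrr; apply/esym/eqP.
  by rewrite -size_poly_eq0 -leqn0.
(* The image of [c *: 'X^k] has the same coefficient as [f] in degree [m]
   and none above; it has degree [k - 1] when [y = z], and [k] otherwise. *)
have [k [c hk]] : exists k c, forall j, (m <= j)%N ->
    f`_j = c * (y * 'C(k, j)%:R - z * (j == k)%:R).
  have fj j : (m < j)%N -> f`_j = 0 by move=> mj; rewrite nth_default ?(leq_trans sf).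
  have [yz|yz] := eqVneq y z.
    exists m.+1, (f`_m / (y * m.+1%:R)) => j.
    rewrite leq_eqVlt => /predU1P[<-|mj].
      by rewrite binSn ltn_eqF // mulr0 subr0 divfK // mulf_neq0 ?pnatr_eq0.
    rewrite fj // -yz; move: mj; rewrite leq_eqVlt => /predU1P[<-|mj].
      by rewrite binn eqxx subrr mulr0.
    by rewrite bin_small // gtn_eqF // !mulr0 subr0 mulr0.
  exists m, (f`_m / (y - z)) => j.
  rewrite leq_eqVlt => /predU1P[<-|mj].
    by rewrite binn eqxx !mulr1 divfK // subr_eq0.
  by rewrite fj // bin_small // gtn_eqF // !mulr0 subr0 mulr0.
pose T h := y *: (h \Po ('X + 1)) - z *: h.
have [h Th] : exists h, T h = f - T (c *: 'X^k).
  apply: IH; apply/leq_sizeP => j mj.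
  rewrite /T coefB hk // coefB !coefZ comp_polyZ comp_Xn_poly !coefZ.
  by rewrite coef_Xadd1_exp coefXn; ring.
exists (h + c *: 'X^k); rewrite -[RHS](subrK (T (c *: 'X^k))) -Th /T.
by rewrite comp_polyD !scalerDr; ring.
Qed.

(** Sequences form a module over [{poly K}] with ['X] as the shift; a recurrence says that its
    characteristic polynomial annihilates the sequence. *)
Definition act q V (n : int) := \sum_(i < size q) q`_i * V (n + i%:Z).

Lemma act_widen q V n k : (size q <= k)%N ->
  act q V n = \sum_(i < k) q`_i * V (n + i%:Z).
Proof.
move=> sk; rewrite /act (big_ord_widen k (fun i => q`_i * V (n + i%:Z))) //.
rewrite big_mkcond /=; apply: eq_bigr => i _; case: ltnP => // h.
by rewrite nth_default ?mul0r.
Qed.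

Lemma eq_act q V W : V =1 W -> act q V =1 act q W.
Proof. by move=> e n; apply: eq_bigr => i _; rewrite e. Qed.

Lemma act0r q V n : (forall k, V k = 0) -> act q V n = 0.
Proof. by move=> V0; rewrite /act big1 // => i _; rewrite V0 mulr0. Qed.

Lemma actDl p q V n : act (p + q) V n = act p V n + act q V n.
Proof.
set k := maxn (size p) (size q).
rewrite !(@act_widen _ _ _ k) ?leq_maxl ?leq_maxr ?size_polyD //.
by rewrite -big_split; apply: eq_bigr => i _; rewrite coefD mulrDl.
Qed.

Lemma actZl c q V n : act (c *: q) V n = c * act q V n.
Proof.
rewrite (@act_widen (c *: q) _ _ (size q)) ?size_scale_leq // mulr_sumr.
by apply: eq_bigr => i _; rewrite coefZ mulrA.
Qed.

Lemma act1 V n : act 1 V n = V n.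
Proof. by rewrite /act size_poly1 big_ord1 coefC mul1r addr0. Qed.

Lemma actXM q V n : act ('X * q) V n = act q V (n + 1).
Proof.
rewrite (@act_widen _ _ _ (size q).+1); last first.
  by rewrite (leq_trans (size_polyMleq _ _)) // size_polyX.
rewrite big_ord_recl coefXM mul0r add0r; apply: eq_bigr => i _.
by rewrite coefXM /= /bump add1n -addrA -PoszD.
Qed.

Lemma actM p q V n : act (p * q) V n = act p (act q V) n.
Proof.
elim/poly_ind: p n => [|p c IH] n.
  by rewrite mul0r /act !size_poly0 !big_ord0.
rewrite mulrDl (mulrC p) -mulrA mul_polyC !actDl !actXM IH actZl.
by rewrite -[c%:P]mulr1 mul_polyC actZl act1.
Qed.

Lemma act_XsubC z V n : act ('X - z%:P) V n = V (n + 1) - z * V n.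
Proof.
by rewrite -polyCN actDl -['X]mulr1 actXM -[(- z)%:P]mulr1 mul_polyC actZl !act1 mulNr.
Qed.

Lemma act_XsubCM z q V n :
  act (('X - z%:P) * q) V n = act q (fun m => V (m + 1) - z * V m) n.
Proof. by rewrite mulrC actM; apply: eq_act => m; rewrite act_XsubC. Qed.

Lemma act_expz q c z n : z != 0 -> act q (fun m => c * z ^ m) n = c * q.[z] * z ^ n.
Proof.
move=> z0; rewrite /act horner_coef mulr_sumr mulr_suml; apply: eq_bigr => i _.
by rewrite expfzDr // -exprnP; ring.
Qed.

Lemma geometric_act z V : z != 0 -> (forall n, act ('X - z%:P) V n = 0) ->
  forall n, V n = V 0 * z ^ n.
Proof.
move=> z0 h; have VS n : V (n + 1) = z * V n.
  by apply/eqP; rewrite -subr_eq0 -act_XsubC h.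
elim/int_ind => [|n IH|n IH]; first by rewrite mulr1.
  by rewrite intS addrC VS IH expfzDr // expr1z mulrCA [z * _]mulrC.
apply: (mulfI z0); rewrite -VS mulrCA -[X in X * z ^ _]expr1z -expfzDr //.
have -> : 1 + - n.+1%:Z = - n%:Z by lia.
by rewrite -IH; congr V; lia.
Qed.

(** The [F z] may vanish here; indexing them by field elements avoids numbering the roots. *)
Definition exp_poly S V :=
  exists F : K -> {poly K}, forall n, V n = \sum_(z <- S) (F z).[n%:~R] * z ^ n.

(** A solution [V] is found term by term; [W - V] is then geometric of ratio [z] and joins the term
    of [z] as a constant. *)
Lemma first_order_solve (S : seq K) z W : uniq S -> 0 \notin S -> z \in S ->
  exp_poly S (fun n => W (n + 1) - z * W n) -> exp_poly S W.
Proof.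
move=> uS S0 zS [F HF].
have z0 : z != 0 by apply: contraNneq S0 => <-.
(* The boolean implication also holds at [y = 0], so that [xchoose] yields a total function. *)
have ex y : exists h, (y != 0) ==> (y *: (h \Po ('X + 1)) - z *: h == F y).
  have [->|y0] := eqVneq y 0; first by exists 0.
  by have [h /eqP] := twisted_difference_surjective z (F y) y0; exists h.
pose h y := xchoose (ex y).
have hP y : y != 0 -> y *: (h y \Po ('X + 1)) - z *: h y = F y.
  by move=> y0; apply/eqP/(implyP (xchooseP (ex y))).
pose V n := \sum_(y <- S) (h y).[n%:~R] * y ^ n.
have VS n : V (n + 1) - z * V n = W (n + 1) - z * W n.
  rewrite HF mulr_sumr -sumrB; apply: eq_big_seq => y yS.
  have y0 : y != 0 by apply: contraNneq S0 => <-.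
  rewrite -hP // hornerD hornerN !hornerZ horner_comp !hornerE.
  by rewrite expfzDr // rmorphD /= expr1z; ring.
pose D n := W n - V n.
have Dn n : D n = D 0 * z ^ n.
  apply: geometric_act z0 _ n => {}n; rewrite act_XsubC; move: (VS n) => e.
  by rewrite /D -[W (n + 1)](subrK (z * W n)) -e; ring.
exists (fun y => h y + (if y == z then (D 0)%:P else 0)) => n.
rewrite -[LHS](subrK (V n)) addrC -/(D n) Dn /V.
under [RHS]eq_bigr do rewrite hornerD mulrDl.
rewrite big_split /=; congr (_ + _).
rewrite (bigD1_seq z) //= eqxx hornerC big1 ?addr0 // => y /negbTE ->.
by rewrite horner0 mul0r.
Qed.

(** One first-order equation is solved for each entry of [s], which may repeat roots, while [S]
    stays fixed. *)
Lemma act_prod_exp_poly S (s : seq K) V : uniq S -> 0 \notin S -> {subset s <= S} ->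
  (forall n, act (\prod_(z <- s) ('X - z%:P)) V n = 0) -> exp_poly S V.
Proof.
move=> uS S0; elim: s V => [|z s IH] V sS.
  rewrite big_nil => h; exists (fun=> 0) => n.
  by rewrite -[LHS]act1 h big1 // => y _; rewrite horner0 mul0r.
rewrite big_cons => h; apply: (@first_order_solve _ z) => //.
  by apply: sS; rewrite mem_head.
by apply: IH => [y ys|n]; [apply: sS; rewrite inE ys orbT | rewrite -act_XsubCM].
Qed.

(** One factor sends [f.[m] * z ^ m] to [z * (f.[m + 1] - f.[m]) * z ^ m], and the difference lowers
    the size. *)
Lemma act_XsubC_exp_polyM z f n k : z != 0 -> (size f <= k)%N ->
  act (('X - z%:P) ^+ k) (fun m => f.[m%:~R] * z ^ m) n = 0.
Proof.
move=> z0; elim: k f => [|k IH] f sf.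
  rewrite expr0 act1 (_ : f = 0) ?horner0 ?mul0r //.
  by apply/eqP; rewrite -size_poly_eq0 -leqn0.
rewrite exprS act_XsubCM.
have [->|f0] := eqVneq f 0.
  by apply: act0r => m; rewrite !horner0 !mul0r mulr0 subrr.
pose g := z *: (f \Po ('X + 1) - f).
rewrite -[RHS](IH g) //; last first.
  rewrite (leq_trans (size_scale_leq _ _)) //; apply/leq_sizeP => j kj.
  have sfX : size (f \Po ('X + 1)) = size f.
    by rewrite size_comp_poly2 // -[1](opprK 1) -polyC1 -polyCN size_XsubC.
  (* Only degree [k] is at stake, and there the two leading coefficients agree. *)
  move: kj; rewrite leq_eqVlt => /predU1P[<-|kj]; last first.
    by rewrite coefB !nth_default ?subrr ?sfX // (leq_trans sf).
  have [sk|sk] := eqVneq (size f) k.+1; last first.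
    have : (size f <= k)%N by rewrite -ltnS ltn_neqAle sk sf.
    by move=> ?; rewrite coefB !nth_default ?subrr ?sfX.
  have l (q : {poly K}) : size q = k.+1 -> q`_k = lead_coef q.
    by rewrite /lead_coef => ->.
  rewrite coefB !l ?sfX // lead_coef_comp; last first.
    by rewrite -[1](opprK 1) -polyC1 -polyCN size_XsubC.
  by rewrite -[1](opprK 1) -polyC1 -polyCN lead_coefXsubC expr1n mulr1 subrr.
apply: eq_act => m; rewrite /g hornerZ hornerD hornerN horner_comp !hornerE.
by rewrite expfzDr // rmorphD /= expr1z; ring.
Qed.

(** Annihilated by ['X - y%:P], the sequence [act g V] is a multiple of [y ^ n]. It is also
    annihilated by [H], which multiplies [y ^ n] by [H.[y] != 0]; so it vanishes. *)
Lemma missing_root_act S (F : K -> {poly K}) y g V :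
    uniq S -> 0 \notin S -> y \in S -> F y = 0 ->
    (forall n, V n = \sum_(z <- S) (F z).[n%:~R] * z ^ n) ->
    (forall n, act (('X - y%:P) * g) V n = 0) ->
  forall n, act g V n = 0.
Proof.
move=> uS S0 yS Fy HV Vg.
have y0 : y != 0 by apply: contraNneq S0 => <-.
pose D := act g V.
have Dn : forall n, D n = D 0 * y ^ n.
  by apply: geometric_act => // n; rewrite -actM.
pose H := \prod_(z <- S | z != y) ('X - z%:P) ^+ size (F z).
have HVn n : act H V n = 0.
  rewrite (eq_act _ HV) /act.
  under eq_bigr do rewrite mulr_sumr.
  rewrite exchange_big big_seq big1 //= => z zS.
  rewrite -/(act H (fun n => (F z).[n%:~R] * z ^ n) n).
  have [->|zy] := eqVneq z y.
    by apply: act0r => m; rewrite Fy horner0 mul0r.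
  rewrite /H big_mkcond (bigD1_seq z) //= zy mulrC actM.
  apply: act0r => k; rewrite act_XsubC_exp_polyM //.
  by apply: contraNneq S0 => <-.
have e : D 0 * H.[y] * y ^ 0 = 0.
  rewrite -act_expz // -(eq_act _ Dn) /D -actM mulrC actM.
  exact: act0r.
have Hy : H.[y] != 0.
  rewrite /H horner_prod; elim/big_ind: _ => [|a b|z zy]; first exact: oner_neq0.
    exact: mulf_neq0.
  by rewrite horner_exp hornerXsubC expf_neq0 // subr_eq0 eq_sym.
move/eqP: e; rewrite mulr1 mulf_eq0 (negbTE Hy) orbF => /eqP D0 n.
by rewrite -/(D n) Dn D0 mul0r.
Qed.

End LinearRecurrences.

(** * Minimal order and descent to rational coefficients *)

(** Zero low coefficients are removed one at a time: if [c ord0 = 0], replacing [n] by [n - 1]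
    lowers the order by one. *)
Lemma recurrence_of_weak (U : int -> rat) m (c : 'I_m -> rat) :
    (forall n, U (n + m%:Z) = \sum_(i < m) c i * U (n + i%:Z)) ->
  exists2 m', (m' <= m)%N & exists c' : 'I_m' -> rat, recurrence U c'.
Proof.
elim: m c => [|m IH] c h; first by exists 0%N => //; exists c; split=> // [[]].
have [c0|c0] := eqVneq (c ord0) 0; last first.
  exists m.+1 => //; exists c; split=> // i i0.
  by rewrite (_ : i = ord0) //; apply: val_inj.
have [n|m' lem H] := IH (fun i => c (lift ord0 i)).
  have := h (n - 1); rewrite big_ord_recl c0 mul0r add0r.
  rewrite (_ : n - 1 + m.+1%:Z = n + m%:Z); last by lia.
  move=> ->; apply: eq_bigr => i _; congr (_ * U _).
  by rewrite /= /bump add1n; lia.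
by exists m' => //; apply: leqW.
Qed.

(** In a number field containing the [c i], some coordinate form is nonzero at 1. It is
    [rat]-linear, so its values at the [c i], divided by its value at 1, give [c']. *)
Lemma descend_recurrence (U : int -> rat) m (c : 'I_m -> algC) :
    (forall n, ratr (U (n + m%:Z)) = \sum_(i < m) c i * ratr (U (n + i%:Z))) ->
  exists c' : 'I_m -> rat,
    forall n, U (n + m%:Z) = \sum_(i < m) c' i * U (n + i%:Z).
Proof.
move=> h.
have [Qs [QsC [s1 Ds _]]] := num_field_exists [seq c i | i <- enum 'I_m].
pose e (i : 'I_m) := s1`_i.
have sz : size s1 = m by rewrite -(size_map QsC) Ds size_map size_enum_ord.
have De i : c i = QsC (e i).
  rewrite -(nth_map 0 0) ?sz // Ds (nth_map i) ?size_enum_ord //.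
  by rewrite nth_ord_enum.
have hQ n : (U (n + m%:Z))%:A = \sum_(i < m) U (n + i%:Z) *: e i.
  apply: (fmorph_inj QsC); rewrite rmorph_sum /= alg_num_field fmorph_rat h.
  apply: eq_bigr => i _.
  by rewrite -[_ *: _]mulr_algl alg_num_field rmorphM /= fmorph_rat De mulrC.
pose L j : Qs -> rat := coord (vbasis {:Qs}) j.
have [j Lj] : exists j, L j 1 != 0.
  apply/existsP; apply: contraTT isT; rewrite negb_exists => /forallP L0.
  have := oner_neq0 Qs; rewrite (coord_vbasis (memvf 1)) big1 ?eqxx // => j _.
  by have /negbNE/eqP := L0 j; rewrite /L => ->; rewrite scale0r.
exists (fun i => L j (e i) / L j 1) => n.
apply: (mulIf Lj); have := congr1 (L j) (hQ n).
rewrite /L linearZ /= => ->; rewrite linear_sum mulr_suml.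
by apply: eq_bigr => i _; rewrite linearZ /= [RHS]mulrAC divfK // [RHS]mulrC.
Qed.

(** * Existence of the Binet expansion *)

Section Binet.

Variable U : lrs.
Let m := lrs_order U.
Let V (n : int) : algC := ratr (U n).

Lemma coef_charpoly_lt (i : 'I_m) : (lrs_charpoly U)`_i = - lrs_coef i.
Proof.
rewrite /lrs_charpoly coefB coefXn coef_sum ltn_eqF // add0r (bigD1 i) //=.
rewrite coefZ coefXn eqxx mulr1 big1 ?addr0 // => j ne.
by rewrite coefZ coefXn (_ : (i == j :> nat) = false) ?mulr0 // eq_sym; apply/negbTE.
Qed.

Lemma coef_charpoly_ge j : (m <= j)%N -> (lrs_charpoly U)`_j = (j == m)%:R.
Proof.
move=> mj; rewrite /lrs_charpoly coefB coefXn coef_sum big1 ?subr0 // => i _.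
by rewrite coefZ coefXn gtn_eqF ?mulr0 // (leq_trans (ltn_ord i)).
Qed.

Lemma size_charpoly : size (lrs_charpoly U) = m.+1.
Proof.
apply/eqP; rewrite eqn_leq; apply/andP; split.
  by apply/leq_sizeP => j mj; rewrite coef_charpoly_ge ?gtn_eqF // ltnW.
rewrite ltnNge; apply/negP => /leq_sizeP/(_ m (leqnn m))/eqP.
by rewrite coef_charpoly_ge // eqxx oner_eq0.
Qed.

Lemma charpoly_monic : lrs_charpoly U \is monic.
Proof. by rewrite monicE /lead_coef size_charpoly coef_charpoly_ge ?eqxx. Qed.

Lemma lrs_root_rec z : root (map_poly ratr (lrs_charpoly U)) z ->
  z ^+ m = \sum_(i < m) ratr (lrs_coef i) * z ^+ i :> algC.
Proof.
rewrite /root horner_coef size_map_poly size_charpoly big_ord_recr /=.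
rewrite coef_map /= coef_charpoly_ge // eqxx rmorph1 mul1r addrC.
rewrite addr_eq0 => /eqP->; rewrite -sumrN; apply: eq_bigr => i _.
by rewrite coef_map /= coef_charpoly_lt rmorphN mulNr opprK.
Qed.

(** At [z = 0] the relation would read [0 = lrs_coef ord0], or [1 = 0] in order 0. *)
Lemma lrs_root_neq0 (z : algC) :
  root (map_poly ratr (lrs_charpoly U)) z -> z != 0.
Proof.
move=> /lrs_root_rec; apply: contra_eq_neq => ->.
have [m0 _] := lrs_rec U; rewrite -/m in m0 *.
case: (posnP m) => [e|m_gt0].
  rewrite expr0n (introT eqP e) big1 ?oner_neq0 // => i.
  by have := ltn_ord i; rewrite [X in (_ < X)%N]e.
rewrite expr0n gtn_eqF // eq_sym (bigD1 (Ordinal m_gt0)) //= mulr1 big1 ?addr0.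
  by rewrite fmorph_eq0 m0.
move=> i ne; rewrite expr0n (_ : (i == 0 :> nat)%N = false) ?mulr0 //.
exact/negbTE.
Qed.

Lemma act_charpoly n : act (map_poly ratr (lrs_charpoly U)) V n = 0.
Proof.
rewrite /act size_map_poly size_charpoly big_ord_recr /= coef_map /=.
rewrite coef_charpoly_ge // eqxx rmorph1 mul1r /V.
have [_ ->] := lrs_rec U; rewrite rmorph_sum -big_split big1 //= => i _.
by rewrite coef_map /= coef_charpoly_lt rmorphM rmorphN mulNr addNr.
Qed.

(** Such a [g] is a recurrence of order [(size g).-1] over [algC]; it descends to [rat], and
    minimality applies once zero low coefficients are removed. *)
Lemma act_small_eq0 (g : {poly algC}) : g \is monic ->
  (forall n, act g V n = 0) -> (m < size g)%N.
Proof.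
move=> gmon gV; have g0 : g != 0 by apply: monic_neq0.
have sg : size g = (size g).-1.+1 by rewrite prednK // size_poly_gt0.
have [n|c Hc] := @descend_recurrence U _ (fun i : 'I_(size g).-1 => - g`_i).
  have := gV n; rewrite /act sg big_ord_recr /=.
  rewrite -[g`_(size g).-1]/(lead_coef g) (monicP gmon) mul1r => /eqP.
  rewrite addrC addr_eq0 /V => /eqP ->; rewrite -sumrN.
  by apply: eq_bigr => i _; rewrite mulNr.
have [m' lem [c' rc]] := recurrence_of_weak Hc.
by rewrite sg ltnS (leq_trans (lrs_min rc)).
Qed.

Lemma binet_expansion_exists : exists s (lam : 'I_s -> algC) f,
  binet_expansion U lam f.
Proof.
have [r Dq] := closed_field_poly_normal (map_poly ratr (lrs_charpoly U) : {poly algC}).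
have qmon : (map_poly ratr (lrs_charpoly U) : {poly algC}) \is monic.
  by rewrite map_monic charpoly_monic.
rewrite (monicP qmon) scale1r in Dq.
pose S := undup r.
have uS : uniq S := undup_uniq r.
have rS (z : algC) : root (map_poly ratr (lrs_charpoly U)) z = (z \in S).
  by rewrite Dq root_prod_XsubC mem_undup.
have S0 : 0 \notin S by apply/negP; rewrite -rS => /lrs_root_neq0/eqP.
have [|n|F HF] := @act_prod_exp_poly _ S r V uS S0.
- by move=> z; rewrite mem_undup.
- by rewrite -Dq act_charpoly.
exists (size S), (fun i => S`_i), (fun i => F S`_i); split.
- by move=> i j /eqP; rewrite nth_uniq // => /eqP; apply: val_inj.
- move=> z; rewrite rS; split=> [/(nthP 0)[i lti <-]|[i <-]].
    by exists (Ordinal lti).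
  exact: mem_nth.
(* Otherwise [g], the characteristic polynomial with one factor ['X - y%:P] removed, would still
   annihilate [V], with size only [m]. *)
- move=> i; apply/eqP => Fi0; set y := S`_i in Fi0.
  have yS : y \in S by apply: mem_nth.
  have yr : y \in r by rewrite -mem_undup.
  pose g := \prod_(z <- rem y r) ('X - z%:P).
  have qg : map_poly ratr (lrs_charpoly U) = ('X - y%:P) * g.
    by rewrite Dq (perm_big _ (perm_to_rem yr)) big_cons.
  have gmon : g \is monic by apply: monic_prod => z _; apply: monicXsubC.
  have /(act_small_eq0 gmon) : forall n, act g V n = 0.
    apply: (missing_root_act uS S0 yS Fi0 HF) => n.
    by rewrite -qg act_charpoly.
  have := congr1 (fun p : {poly algC} => size p) qg.
  rewrite size_map_poly size_charpoly size_Mmonic ?polyXsubC_eq0 // size_XsubC /=.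
  by move=> [->]; rewrite ltnn.
- by move=> n; rewrite -/(V n) HF (big_nth 0) big_mkord.
Qed.

End Binet.

(** * Divisibility by powers of p among algebraic numbers *)

(** Gives access to the transitivity of [integralOver], used in [Aint_root]. *)
Lemma Aint_integral (x : algC) :
  reflect (integralOver (intr : int -> algC) x) (x \in Aint).
Proof.
apply: (iffP idP) => [/floorpP[q Dq]|[q qmon rq]].
  exists q; last by rewrite -Dq root_minCpoly.
  have := minCpoly_monic x; rewrite Dq !monicE lead_coef_map_inj ?rmorph0 //.
    by move/eqP=> e; apply/eqP/(@intr_inj algC); rewrite e.
  exact: intr_inj.
apply: (root_monic_Aint rq); first exact: monic_map.
by apply/polyOverP => i; rewrite coef_map /= intr_int.
Qed.

Lemma Aint_root m (c : 'I_m -> algC) x : (forall i, c i \in Aint) ->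
  x ^+ m = \sum_(i < m) c i * x ^+ i -> x \in Aint.
Proof.
move=> cA h.
pose q : {poly algC} := \sum_(i < m) c i *: 'X^i.
have sq : (size q <= m)%N.
  apply: (leq_trans (size_sum _ _ _)); apply/bigmax_leqP => i _.
  by rewrite (leq_trans (size_scale_leq _ _)) // size_polyXn.
apply/Aint_integral/(@integral_root_monic _ _ _ x ('X^m - q)).
- by rewrite monicE lead_coefDl ?lead_coefXn // size_polyN size_polyXn.
- rewrite /root hornerD hornerN hornerXn h horner_sum subr_eq0; apply/eqP.
  by apply: eq_bigr => i _; rewrite hornerZ hornerXn.
move=> _ /(nthP 0)[i _ <-]; apply/Aint_integral.
rewrite coefB coefXn coef_sum rpredB ?rpred_nat // rpred_sum // => k _.
by rewrite coefZ coefXn rpredM // rpred_nat.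
Qed.

(** Multiplied by [d ^+ m], the equation becomes a monic one for [d * x]. *)
Lemma Aint_scale_root m (c : 'I_m -> algC) x d : d \in Aint ->
    (forall i, d * c i \in Aint) ->
  x ^+ m = \sum_(i < m) c i * x ^+ i -> d * x \in Aint.
Proof.
move=> dA cA h.
apply: (@Aint_root m (fun i => d ^+ (m - i.+1) * (d * c i))) => [i|].
  by rewrite rpredM // rpredX.
rewrite exprMn h mulr_sumr; apply: eq_bigr => i _.
have -> : d ^+ m = d ^+ (m - i.+1) * (d * d ^+ i).
  by rewrite -exprS -exprD subnK.
by rewrite exprMn; ring.
Qed.

Lemma ratr_denq (r : rat) : (`|denq r|%N)%:R * ratr r = (numq r)%:~R :> algC.
Proof.
rewrite /ratr -[X in X * _]/((Posz _)%:~R) absz_denq mulrC divfK //.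
by rewrite intr_eq0 denq_neq0.
Qed.

Lemma rat_common_denominator m (c : 'I_m -> rat) :
  let d := (\prod_i `|denq (c i)|)%N in forall i, d%:R * ratr (c i) \in Aint.
Proof.
move=> d i; rewrite /d (bigD1 i) //= natrM mulrAC ratr_denq.
by rewrite rpredM ?rpred_nat // Aint_int.
Qed.

(** A common denominator of the coefficients of the minimal polynomial serves as [d]. *)
Lemma Aint_denominator (x : algC) : exists2 d, (0 < d)%N & d%:R * x \in Aint.
Proof.
have [q [Dq qmon] _] := minCpolyP x.
have [c0 Hc] : exists c : 'I_(size q).-1 -> rat,
    x ^+ (size q).-1 = \sum_(i < (size q).-1) ratr (c i) * x ^+ i.
  exists (fun i => - q`_i); have := root_minCpoly x.
  rewrite Dq /root horner_coef size_map_poly -(@prednK (size q)); last first.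
    by rewrite size_poly_gt0 monic_neq0.
  rewrite big_ord_recr /= coef_map /= -[q`_(size q).-1]/(lead_coef q).
  rewrite (monicP qmon) rmorph1 mul1r addrC addr_eq0 => /eqP->; rewrite -sumrN.
  by apply: eq_bigr => i _; rewrite coef_map rmorphN mulNr.
exists (\prod_i `|denq (c0 i)|)%N.
  by rewrite prodn_gt0 // => i; rewrite absz_gt0 denq_neq0.
apply: Aint_scale_root Hc; first exact: rpred_nat.
exact: rat_common_denominator.
Qed.

(** * Arithmetic in the integral closure of [Z_(p)] *)

Section LocalIntegers.

Variable p : nat.
Hypothesis p_prime : prime p.

(* The integral closure of [Z_(p)] in [algC]; [p_dvd j] is the ideal generated
   by [p ^ j] in this ring. *)
Definition p_integral (x : algC) := exists2 d, ~~ (p %| d)%N & d%:R * x \in Aint.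

Definition p_dvd j (x : algC) := p_integral (x / p%:R ^+ j).

Let p_neq0 : p%:R != 0 :> algC.
Proof. by rewrite pnatr_eq0 -lt0n prime_gt0. Qed.

Let p_nmul d e : ~~ (p %| d)%N -> ~~ (p %| e)%N -> ~~ (p %| d * e)%N.
Proof. by rewrite Euclid_dvdM // negb_or => -> ->. Qed.

Let p_ndvd1 : ~~ (p %| 1)%N.
Proof. by rewrite dvdn1 neq_ltn prime_gt1 ?orbT. Qed.

Lemma p_integral_Aint x : x \in Aint -> p_integral x.
Proof. by exists 1%N; rewrite ?mul1r. Qed.

Lemma p_integralM x y : p_integral x -> p_integral y -> p_integral (x * y).
Proof.
move=> [d hd dx] [e he ey]; exists (d * e)%N; first exact: p_nmul.
by rewrite natrM mulrACA rpredM.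
Qed.

Lemma p_integralD x y : p_integral x -> p_integral y -> p_integral (x + y).
Proof.
move=> [d hd dx] [e he ey]; exists (d * e)%N; first exact: p_nmul.
rewrite natrM mulrDr; apply: rpredD; last by rewrite -mulrA rpredM ?rpred_nat.
by rewrite mulrAC rpredM ?rpred_nat.
Qed.

Lemma p_integralN x : p_integral x -> p_integral (- x).
Proof. by move=> [d hd dx]; exists d; rewrite ?mulrN ?rpredN. Qed.

Lemma p_integral_sum I (r : seq I) (P : pred I) F :
  (forall i, P i -> p_integral (F i)) -> p_integral (\sum_(i <- r | P i) F i).
Proof.
move=> h; elim/big_ind: _ => //; first exact/p_integral_Aint/rpred0.
exact: p_integralD.
Qed.

Lemma p_integral_prod I (r : seq I) (P : pred I) F :
  (forall i, P i -> p_integral (F i)) -> p_integral (\prod_(i <- r | P i) F i).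
Proof.
move=> h; elim/big_ind: _ => //; first exact/p_integral_Aint/rpred1.
exact: p_integralM.
Qed.

Lemma p_integralX x k : p_integral x -> p_integral (x ^+ k).
Proof.
move=> h; elim: k => [|k IH]; first exact/p_integral_Aint/rpred1.
by rewrite exprS; apply: p_integralM.
Qed.

Lemma p_integralXz x (k : int) : p_integral x -> p_integral x^-1 -> p_integral (x ^ k).
Proof.
move=> h h'; case: k => k; first exact: p_integralX.
by rewrite NegzE -exprz_inv; apply: p_integralX.
Qed.

(** One denominator prime to [p] serves all the [c i], and scaling [x] by it reduces to [Aint]. *)
Lemma p_integral_root m (c : 'I_m -> algC) x : (forall i, p_integral (c i)) ->
  x ^+ m = \sum_(i < m) c i * x ^+ i -> p_integral x.
Proof.
move=> cA h.
have [d hd dA] : exists2 d, ~~ (p %| d)%N & forall i, d%:R * c i \in Aint.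
  have /fin_all_exists2[d hd dA] := cA.
  exists (\prod_i d i)%N; first by elim/big_ind: _.
  by move=> i; rewrite (bigD1 i) //= natrM mulrAC rpredM ?rpred_nat.
by exists d => //; apply: Aint_scale_root h => //; apply: rpred_nat.
Qed.

(** [x] is a root of a monic polynomial with constant term [- x ^+ m]. This serves for
    determinations, known only through a power. *)
Lemma p_integral_radical m x : (0 < m)%N -> p_integral (x ^+ m) -> p_integral x.
Proof.
move=> m0 h; pose c (i : 'I_m) := if i == 0%N :> nat then x ^+ m else 0.
apply: (@p_integral_root m c) => [i|].
  by rewrite /c; case: ifP => // _; apply/p_integral_Aint/rpred0.
rewrite (bigD1 (Ordinal m0)) //= mulr1 big1 ?addr0 // => i ne.
by rewrite /c (_ : (i == 0%N :> nat) = false) ?mul0r //; apply/negbTE.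
Qed.

Lemma p_dvd0 x : p_dvd 0 x <-> p_integral x.
Proof. by rewrite /p_dvd expr0 divr1. Qed.

Lemma p_dvd_zero j : p_dvd j 0.
Proof. by rewrite /p_dvd mul0r; apply/p_integral_Aint/rpred0. Qed.

Lemma p_dvd_integral j x : p_dvd j x -> p_integral x.
Proof.
move=> h; rewrite -[x](divfK (expf_neq0 j p_neq0)).
by apply: p_integralM => //; apply/p_integral_Aint; rewrite rpredX ?rpred_nat.
Qed.

Lemma p_dvd_leq i j x : (i <= j)%N -> p_dvd j x -> p_dvd i x.
Proof.
move=> ij h; apply: (@p_dvd_integral (j - i)).
by rewrite /p_dvd -mulrA -invfM -exprD subnKC.
Qed.

Lemma p_dvdD j x y : p_dvd j x -> p_dvd j y -> p_dvd j (x + y).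
Proof. by rewrite /p_dvd mulrDl; apply: p_integralD. Qed.

Lemma p_dvdN j x : p_dvd j x -> p_dvd j (- x).
Proof. by rewrite /p_dvd mulNr; apply: p_integralN. Qed.

Lemma p_dvdB j x y : p_dvd j x -> p_dvd j y -> p_dvd j (x - y).
Proof. by move=> hx hy; apply/p_dvdD/p_dvdN. Qed.

Lemma p_dvdMl j x y : p_integral x -> p_dvd j y -> p_dvd j (x * y).
Proof. by rewrite /p_dvd -mulrA; apply: p_integralM. Qed.

Lemma p_dvdM i j x y : p_dvd i x -> p_dvd j y -> p_dvd (i + j) (x * y).
Proof. by rewrite /p_dvd exprD invfM mulrACA; apply: p_integralM. Qed.

Lemma p_dvd_sum j I (r : seq I) (P : pred I) F :
  (forall i, P i -> p_dvd j (F i)) -> p_dvd j (\sum_(i <- r | P i) F i).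
Proof. by move=> h; rewrite /p_dvd mulr_suml; apply: p_integral_sum. Qed.

Lemma p_dvd_prodB j I (r : seq I) (F G : I -> algC) :
    (forall i, p_integral (F i)) -> (forall i, p_dvd j (F i - G i)) ->
  p_dvd j (\prod_(i <- r) F i - \prod_(i <- r) G i).
Proof.
move=> FA FG; elim: r => [|i r IH]; first by rewrite !big_nil subrr; apply: p_dvd_zero.
rewrite !big_cons; set a := \prod_(_ <- _) _; set b := \prod_(_ <- _) _.
rewrite (_ : _ - _ = F i * (a - b) + b * (F i - G i)); last by ring.
apply: p_dvdD; apply: p_dvdMl => //; apply: p_integral_prod => k _.
rewrite -(subKr (F k) (G k)); apply: p_integralD => //.
exact/p_integralN/p_dvd_integral/FG.
Qed.

(** Up to a factor [d] prime to [p], the quotient by [p ^ j] is a rational algebraic integer, hence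
    an integer; coprimality removes [d]. *)
Lemma p_dvd_int j (k : int) : p_dvd j k%:~R -> (p ^ j %| `|k|)%N.
Proof.
move=> [d hd]; set y := _ * _ => yA.
have Dy : y * (p%:R ^+ j) = (d%:Z * k)%:~R.
  by rewrite /y mulrA mulfVK ?expf_neq0 // rmorphM.
have yQ : y \in Crat.
  rewrite -[y](mulfK (expf_neq0 j p_neq0)) Dy.
  by rewrite rpred_div // ?rpredX // ?rpred_int ?rpred_nat.
have /intrP[z Dz] := Cint_rat_Aint yQ yA.
have /(@intr_inj algC) e : (z * (p ^ j)%N%:Z)%:~R = (d%:Z * k)%:~R :> algC.
  by rewrite -Dy Dz rmorphM /= -pmulrn natrX.
rewrite -(@Gauss_dvdr _ d); last by rewrite coprimeXl // prime_coprime.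
by rewrite -[X in (_ %| X * _)%N]absz_nat -abszM -e abszM dvdn_mull.
Qed.

(** If [x != 0], some [b > 0] makes [b / x] an algebraic integer, so every power of [p] dividing [x]
    divides [b]; but [p ^ b > b]. *)
Lemma p_dvd_eq0 x : (forall j, p_dvd j x) -> x = 0.
Proof.
move=> h; apply/eqP; apply: contraT => x0.
have [b b0 bA] := Aint_denominator x^-1.
have := @p_dvd_int b b; rewrite absz_nat => H.
have /H/(dvdn_leq b0) : p_dvd b b%:~R.
  rewrite -[b%:~R](divfK x0); apply: p_dvdMl => //.
  exact: p_integral_Aint.
by rewrite leqNgt ltn_expl // prime_gt1.
Qed.

Lemma p_integral_ratrE r : p_integral (ratr r) <-> ~~ (p %| `|denq r|)%N.
Proof.
split=> [[d hd dA]|hr]; last first.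
  by exists `|denq r|%N; rewrite // ratr_denq Aint_int.
have dQ : d%:R * ratr r \in Crat by rewrite rpredM ?rpred_nat // Crat_rat.
have /intrP[z Dz] := Cint_rat_Aint dQ dA.
have /(@intr_inj algC) e : (z * denq r)%:~R = (d%:Z * numq r)%:~R :> algC.
  rewrite !rmorphM /= -Dz -ratr_denq -[X in _ * X = _](_ : (`|denq r|%N)%:R = _).
    by rewrite -pmulrn; ring.
  by rewrite -[LHS]/((Posz _)%:~R) absz_denq.
apply: contra hd => pr.
have := dvdn_mull `|z| pr; rewrite -abszM e abszM absz_nat Euclid_dvdM //.
case/orP=> // pn; have : (p %| gcdn `|numq r| `|denq r|)%N by rewrite dvdn_gcd pn pr.
by rewrite (eqP (coprime_num_den r)) (negbTE p_ndvd1).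
Qed.

(** * Congruences to 1 modulo powers of [p] *)

(** Equal reductions in ['F_p], with denominators cleared, mean that [p] divides the numerator of
    [a - b]. *)
Lemma p_dvd_ratr_diff (a b : rat) :
    ~~ (p %| `|denq a|)%N -> ~~ (p %| `|denq b|)%N ->
    (numq a)%:~R * (denq b)%:~R = (numq b)%:~R * (denq a)%:~R :> 'F_p ->
  p_dvd 1 (ratr a - ratr b).
Proof.
move=> ha hb /eqP; rewrite -!intrM -subr_eq0 -intrB.
rewrite -(dvdz_pcharf (pchar_Fp p_prime)) => /dvdzP[z Dz].
exists (`|denq a| * `|denq b|)%N; first exact: p_nmul.
rewrite expr1 natrM mulrA.
rewrite [X in X \in _]
  (_ : _ = (numq a * denq b - numq b * denq a)%:~R / p%:R); last first.
  have nd r : (denq r)%:~R = (`|denq r|%N)%:R :> algC.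
    by rewrite -[RHS]/((Posz _)%:~R) absz_denq.
  rewrite rmorphB !rmorphM /= -!ratr_denq !nd; congr (_ / _); ring.
by rewrite Dz rmorphM /= -pmulrn mulfK ?Aint_int.
Qed.

(* The powers of [x] lie in the [Z_(p)]-span of [1, x, ..., x ^ m], so two of
   them agree modulo [p]. *)
Lemma p_dvd_expB1 m (c : 'I_m.+1 -> rat) x :
    (forall i, ~~ (p %| `|denq (c i)|)%N) ->
    x ^+ m.+1 = \sum_(i < m.+1) ratr (c i) * x ^+ i -> x != 0 -> p_integral x^-1 ->
  exists2 N, (0 < N)%N & p_dvd 1 (x ^+ N - 1).
Proof.
move=> cA h x0 xVA.
pose pint (r : rat) := ~~ (p %| `|denq r|)%N.
have [u uA Hu] : exists2 u : nat -> 'I_m.+1 -> rat, forall t i, pint (u t i) &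
    forall t, x ^+ t = \sum_i ratr (u t i) * x ^+ i.
  (* Multiplication by [x] shifts the coordinates and rewrites [x ^+ m.+1] through [h]. *)
  pose fix u t : 'I_m.+1 -> rat := fun i => if t is t'.+1 then
    (if i == 0%N :> nat then 0 else u t' (inord i.-1)) + u t' ord_max * c i
    else (i == 0%N :> nat)%:R.
  exists u.
    elim=> [|t IH] i; rewrite -p_integral_ratrE /=.
      by rewrite rmorph_nat; apply/p_integral_Aint/rpred_nat.
    rewrite rmorphD rmorphM /=; apply: p_integralD.
      case: ifP => _; last exact/p_integral_ratrE/IH.
      by rewrite rmorph0; apply/p_integral_Aint/rpred0.
    by apply: p_integralM; apply/p_integral_ratrE; [apply: IH | apply: cA].
  elim=> [|t IH].
    rewrite (bigD1 ord0) //= rmorph1 mul1r big1 ?addr0 // => i ne.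
    by rewrite (_ : (i == 0%N :> nat) = false) ?rmorph0 ?mul0r //; apply/negbTE.
  rewrite exprS IH mulr_sumr big_ord_recr /= [x * _]mulrCA -exprS h mulr_sumr.
  under [RHS]eq_bigr do rewrite rmorphD rmorphM mulrDl -(mulrA (ratr (u t ord_max))).
  rewrite big_split /=; congr (_ + _).
  rewrite big_ord_recl /= rmorph0 mul0r add0r; apply: eq_bigr => i _.
  rewrite /bump /= add1n mulrCA exprS; congr (ratr (u t _) * _).
  by apply: val_inj; rewrite /= inordK add0n // ltnW // ltnS.
pose red (r : rat) : 'F_p := (numq r)%:~R / (denq r)%:~R.
pose k := #|{ffun 'I_m.+1 -> 'F_p}|.
pose v (t : 'I_k.+1) := [ffun i => red (u t i)].
(* Pigeonhole: [k.+1] exponents share [k] coordinate vectors over ['F_p]. *)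
have /injectivePn[t1 [t2 ne12 /ffunP e]] : ~~ injectiveb v.
  apply/negP => /injectiveP/leq_card; rewrite card_ord -/k; lia.
wlog lt12 : t1 t2 ne12 e / (t1 < t2)%N => [W|].
  case: (ltngtP t1 t2) => [lt|lt|/val_inj eq]; last by rewrite eq eqxx in ne12.
    exact: (W t1 t2).
  by apply: (W t2 t1) => //; rewrite eq_sym.
exists (t2 - t1)%N; first by rewrite subn_gt0.
have xA : p_integral x.
  by apply: p_integral_root h => i; apply/p_integral_ratrE/cA.
have D : p_dvd 1 (x ^+ t2 - x ^+ t1).
  rewrite !Hu -sumrB; apply: p_dvd_sum => // i _; rewrite -mulrBl mulrC.
  apply: p_dvdMl; first exact: p_integralX.
  apply: p_dvd_ratr_diff; [exact: uA | exact: uA | ].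
  have dn t : (denq (u t i))%:~R != 0 :> 'F_p.
    rewrite -(dvdz_pcharf (pchar_Fp p_prime)) dvdzE; exact: uA.
  by have := esym (e i); rewrite !ffunE /red => /eqP; rewrite eqr_div // => /eqP.
rewrite (_ : _ - 1 = x^-1 ^+ t1 * (x ^+ t2 - x ^+ t1)).
  by apply: p_dvdMl => //; apply: p_integralX.
rewrite mulrBr -exprMn mulVf // expr1n -{2}(subnKC (ltnW lt12)) exprD mulrA.
by rewrite -exprMn mulVf // expr1n mul1r.
Qed.

(** If [y] is 1 modulo [p ^ k.+1], then [y ^+ p - 1] is [y - 1] times a sum of [p] terms that are 1
    modulo [p]; this sum supplies one more factor [p]. *)
Lemma p_dvd_expB1_iter x k : p_integral x -> p_dvd 1 (x - 1) ->
  p_dvd k.+1 (x ^+ (p ^ k) - 1).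
Proof.
move=> xA hx; elim: k => [|k IH]; first by rewrite expn0 expr1.
have yA := p_integralX (p ^ k) xA; move: yA IH.
rewrite expnSr exprM; set y := x ^+ _ => yA IH.
rewrite subrX1 -addn1; apply: p_dvdM => //.
rewrite -[X in p_dvd _ X](subrK p%:R); apply: p_dvdD => //; last first.
  by rewrite /p_dvd expr1 divff //; apply/p_integral_Aint/rpred1.
rewrite -[p in p%:R]card_ord -sumr_const -sumrB; apply: p_dvd_sum => // i _.
rewrite subrX1 mulrC; apply: p_dvdMl => //; last exact: p_dvd_leq IH.
by apply: p_integral_sum => // l _; apply: p_integralX.
Qed.

Lemma p_dvd_expzB1 x k (e : int) : p_integral x -> p_integral x^-1 -> x != 0 ->
  p_dvd 1 (x - 1) -> (p ^ k %| `|e|)%N -> p_dvd k.+1 (x ^ e - 1).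
Proof.
move=> xA xVA x0 hx /dvdnP[z Dz].
have h : p_dvd k.+1 (x ^+ `|e| - 1).
  rewrite Dz mulnC exprM subrX1 mulrC; apply: p_dvdMl => //.
    by apply: p_integral_sum => // l _; do 2 apply: p_integralX => //.
  exact: p_dvd_expB1_iter.
case: (intP e) h {Dz} => [||n] //; rewrite ?abszN ?absz_nat // => h.
(* A negative exponent reduces to the positive one up to the unit [- x^-1 ^+ n.+1]. *)
rewrite (_ : _ - 1 = x^-1 ^+ n.+1 * - (x ^+ n.+1 - 1)).
  by apply: p_dvdMl => //; [apply: p_integralX | apply: p_dvdN].
by rewrite opprB mulrBr mulr1 -exprMn mulVf // expr1n -exprz_inv.
Qed.

Lemma padic_valP j r : (j%:Z%:E <= padic_val p r)%E ->
  [/\ (p ^ j %| `|numq r|)%N, ~~ (p %| `|denq r|)%N & p_dvd j (ratr r)].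
Proof.
rewrite /padic_val; case: eqP => [->|/eqP r0] h.
  by rewrite rmorph0; split; [exact: dvdn0 | exact: p_ndvd1 | exact: p_dvd_zero].
have n0 : (0 < `|numq r|)%N by rewrite absz_gt0 numq_eq0.
have d0 : (0 < `|denq r|)%N by rewrite absz_gt0 denq_neq0.
rewrite lee_fin in h.
(* As [j] is nonnegative, a factor [p] of the denominator would force one in the numerator, against
   coprimality. *)
have nd : ~~ (p %| `|denq r|)%N.
  apply/negP => pd.
  have : (0 < logn p `|denq r|)%N by rewrite logn_gt0 mem_primes p_prime d0.
  move=> ld; have : (0 < logn p `|numq r|)%N by lia.
  rewrite logn_gt0 mem_primes p_prime n0 /= => pn.
  have : (p %| gcdn `|numq r| `|denq r|)%N by rewrite dvdn_gcd pn pd.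
  by rewrite (eqP (coprime_num_den r)) (negbTE p_ndvd1).
have dn : (p ^ j %| `|numq r|)%N.
  by rewrite pfactor_dvdn //; lia.
split=> //; exists `|denq r|%N => //; rewrite mulrA ratr_denq.
have /dvdzP[z ->] : (Posz (p ^ j) %| numq r)%Z by rewrite dvdzE.
by rewrite rmorphM /= -pmulrn natrX mulfK ?expf_neq0 ?Aint_int.
Qed.

(** * Products over roots of unity *)

(** The factorization of ['X^L - 1] is evaluated at [x / w] and multiplied by [w ^+ L]. *)
Lemma prod_unity_rootB L (z x w : algC) : L.-primitive_root z -> w != 0 ->
  \prod_(t < L) (x - z ^+ t * w) = x ^+ L - w ^+ L.
Proof.
move=> zL w0; have /(congr1 (fun q => q.[x / w])) := factor_Xn_sub_1 zL.
rewrite hornerD hornerN hornerXn hornerC big_mkord horner_prod => e.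
rewrite (_ : x ^+ L - w ^+ L = w ^+ L * ((x / w) ^+ L - 1)); last first.
  by rewrite mulrBr mulr1 -exprMn mulrC divfK // -exprMn [w * _]mulrC divfK.
rewrite -e -[X in w ^+ X]card_ord -prodr_const -big_split /=.
by apply: eq_bigr => t _; rewrite hornerXsubC mulrBr [w * (x / w)]mulrC
  divfK // [w * _]mulrC.
Qed.

(* Cantor's diagonal argument: otherwise each [i] misses some value [T i], and
   the function [T] itself has no admissible image under [phi]. *)
Lemma diagonal_full_index (I J : finType) (phi : {ffun {ffun I -> J} -> I}) :
  exists i, exists tau : J -> {ffun I -> J},
    forall t, phi (tau t) = i /\ tau t i = t.
Proof.
have [/existsP[i /forallP h]|] := boolP
  [exists i, forall t, exists xi : {ffun I -> J}, (phi xi == i) && (xi i == t)].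
  exists i; apply: (@fin_all_exists _ _ (fun t xi => phi xi = i /\ xi i = t)) => t.
  by have /existsP[xi /andP[/eqP ? /eqP ?]] := h t; exists xi.
rewrite negb_exists => /forallP h.
have /fin_all_exists[T HT] : forall i, exists t, forall xi : {ffun I -> J},
    ~~ ((phi xi == i) && (xi i == t)).
  move=> i; have := h i; rewrite negb_forall => /existsP[t].
  by rewrite negb_exists => /forallP ht; exists t.
by have := HT (phi (finfun T)) (finfun T); rewrite eqxx ffunE eqxx.
Qed.

(* The product over all [xi] of the twisted sums is divisible by every power of
   [p]: replacing [z ^+ xi i * w i] by [z ^+ xi i * w i - x i] and
   expanding, each term is a multiple of some [x i ^+ L - w i ^+ L]. *)
Lemma twisted_sum_eq0 s L (z : algC) (g w : 'I_s -> algC) :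
    L.-primitive_root z ->
    (forall i, p_integral (g i)) -> (forall i, p_integral (w i)) ->
    (forall i, w i != 0) ->
    (forall j, exists2 x : 'I_s -> algC, forall i, p_integral (x i) &
      (forall i, p_dvd j (x i ^+ L - w i ^+ L)) /\ p_dvd j (\sum_i g i * x i)) ->
  exists xi : 'I_s -> nat, \sum_i g i * (z ^+ xi i * w i) = 0.
Proof.
move=> zL gA wA w0 hx.
have zA k : p_integral (z ^+ k).
  by apply/p_integralX/p_integral_Aint/(Aint_prim_root zL).
pose F (xi : {ffun 'I_s -> 'I_L}) := \sum_i g i * (z ^+ xi i * w i).
have FA xi : p_integral (F xi).
  by apply: p_integral_sum => i _; do 2 apply: p_integralM => //.
suff /eqP : \prod_xi F xi = 0.
  by move/prodf_eq0 => [xi _ /eqP]; exists (fun i => nat_of_ord (xi i)).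
apply: p_dvd_eq0 => j; have [x xA [xw gx]] := hx j.
pose G (xi : {ffun 'I_s -> 'I_L}) i := g i * (z ^+ xi i * w i - x i).
have GA xi i : p_integral (G xi i).
  apply: p_integralM => //; apply: p_integralD; last exact: p_integralN.
  exact: p_integralM.
(* Modulo [p ^ j], each [F xi] may be replaced by the sum of the [G xi i]: they differ by
   [\sum_i g i * x i]. *)
rewrite -[X in p_dvd _ X](subrK (\prod_xi \sum_i G xi i)); apply: p_dvdD.
  apply: p_dvd_prodB => // xi; rewrite /F -sumrB.
  rewrite (eq_bigr (fun i => g i * x i)) // => i _.
  by rewrite /G -mulrBr subKr.
rewrite bigA_distr_bigA; apply: p_dvd_sum => phi _.
(* A term of the expansion picks an index [phi xi] for each [xi]; along [tau] this index is always
   [i], while [tau t i] takes every value. *)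
have [i [tau htau]] := diagonal_full_index phi.
rewrite (bigID (mem [set tau t | t : 'I_L])) /= mulrC; apply: p_dvdMl.
  exact: p_integral_prod.
rewrite big_imset /=; last first.
  by move=> t1 t2 _ _ e; rewrite -(htau t1).2 -(htau t2).2 e.
rewrite (eq_bigr (fun t : 'I_L => (- g i) * (x i - z ^+ t * w i))); last first.
  by move=> t _; have [-> et] := htau t; rewrite /G et; ring.
rewrite big_split /= prod_unity_rootB //; apply: p_dvdMl => //.
by apply: p_integral_prod => t _; apply: p_integralN.
Qed.

(** The constant coefficient is a unit of [Z_(p)], so dividing the equation by [x] expresses [x^-1]
    through powers of [x]. *)
Lemma p_integral_unit m (c : 'I_m -> rat) (x : algC) :
    (forall i, ~~ (p %| `|denq (c i)|)%N) ->
    (forall i : 'I_m, i = 0%N :> nat -> ~~ (p %| `|numq (c i)|)%N) ->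
    x != 0 -> x ^+ m = \sum_(i < m) ratr (c i) * x ^+ i ->
  [/\ p_integral x, p_integral x^-1
    & exists2 N, (0 < N)%N & p_dvd 1 (x ^+ N - 1)].
Proof.
case: m c => [|m] c cA c0 x0 h.
  (* In order 0 the equation reads [1 = 0]. *)
  by move/eqP: h; rewrite big_ord0 oner_eq0.
have xA : p_integral x.
  by apply: p_integral_root h => i; apply/p_integral_ratrE/cA.
suff xVA : p_integral x^-1 by split=> //; apply: p_dvd_expB1 h _ _.
have n0 : ratr (c ord0) != 0 :> algC.
  rewrite fmorph_eq0; apply: contraNneq (c0 ord0 erefl) => ->; exact: dvdn0.
have -> : x^-1 = (ratr (c ord0))^-1 *
    (x ^+ m - \sum_(i < m) ratr (c (lift ord0 i)) * x ^+ i).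
  apply: (mulfI n0); rewrite mulVKf //; apply: (mulfI x0).
  rewrite mulrCA divff // mulr1 mulrBr -exprS h big_ord_recl mulr1 mulr_sumr.
  rewrite (eq_bigr (fun i : 'I_m => x * (ratr (c (lift ord0 i)) * x ^+ i))).
    by rewrite addrK.
  by move=> i _; rewrite /= /bump add1n exprS; ring.
apply: p_integralM.
  exists `|numq (c ord0)|%N; first exact: c0.
  rewrite -[X in X / _]/((Posz _)%:~R) abszEsg rmorphM /= -ratr_denq.
  by rewrite mulrA mulfK // rpredM ?rpred_nat ?Aint_int.
apply: p_integralD; first exact: p_integralX.
apply/p_integralN/p_integral_sum => i _; apply: p_integralM.
  exact/p_integral_ratrE/cA.
exact: p_integralX.
Qed.

(** [x - y] divides each [x ^+ i - y ^+ i]. *)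
Lemma p_dvd_hornerB j (q : {poly algC}) x y : (forall k, p_integral q`_k) ->
  p_integral x -> p_integral y -> p_dvd j (x - y) -> p_dvd j (q.[x] - q.[y]).
Proof.
move=> qA xA yA xy; rewrite !horner_coef -sumrB; apply: p_dvd_sum => i _.
rewrite -mulrBr subrXX mulrCA mulrC; apply: p_dvdMl => //.
apply: p_integralM => //; apply: p_integral_sum => k _.
by apply: p_integralM; apply: p_integralX.
Qed.

End LocalIntegers.

Lemma poly_common_denominator s (f : 'I_s -> {poly algC}) :
  exists2 d, (0 < d)%N & forall i k, (d%:R *: f i)`_k \in Aint.
Proof.
have /fin_all_exists2[d d0 dA] : forall i, exists2 d, (0 < d)%N &
    forall k : 'I_(size (f i)), d%:R * (f i)`_k \in Aint.
  move=> i; have /fin_all_exists2[d d0 dA] :=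
    fun k : 'I_(size (f i)) => Aint_denominator (f i)`_k.
  exists (\prod_k d k)%N; first by rewrite prodn_gt0.
  by move=> k; rewrite (bigD1 k) //= natrM mulrAC rpredM ?rpred_nat.
exists (\prod_i d i)%N; first by rewrite prodn_gt0.
move=> i k; rewrite coefZ; case: (ltnP k (size (f i))) => hk; last first.
  by rewrite nth_default // mulr0 rpred0.
rewrite (bigD1 i) //= natrM mulrAC rpredM ?rpred_nat //.
exact: dA (Ordinal hk).
Qed.

(** * Twisted rational zeros *)

Theorem theorem1p5 (U : lrs) (a : rat) (p : nat)
    (p_regular : regular_prime U p)
    (n : nat -> int)
    (U_lim : tends_to_pinfty (fun k => padic_val p (U (n k))))
    (n_lim : tends_to_pinfty (fun k => padic_val p ((n k)%:~R - a))) :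
  twisted_rational_zero U a.
Proof.
have [s [lam [f Hb]]] := binet_expansion_exists U.
have [lam_inj lam_root f0 HU] := Hb.
exists s, lam, f; split=> //.
have [p_pr cden cnum] := p_regular.
have lroot i : root (map_poly ratr (lrs_charpoly U)) (lam i) by apply/lam_root; exists i.
have l0 i : lam i != 0 by apply: lrs_root_neq0 (lroot i).
have lunit i := p_integral_unit p_pr cden cnum (l0 i) (lrs_root_rec (lroot i)).
have lA i : p_integral p (lam i) by have [] := lunit i.
have lVA i : p_integral p (lam i)^-1 by have [] := lunit i.
have [N N0 HN] : exists2 N, (0 < N)%N & forall i, p_dvd p 1 (lam i ^+ N - 1).
  have /fin_all_exists2[N N0 HN] : forall i,
      exists2 N, (0 < N)%N & p_dvd p 1 (lam i ^+ N - 1).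
    by move=> i; have [] := lunit i.
  exists (\prod_i N i)%N; first by rewrite prodn_gt0.
  move=> i; rewrite (bigD1 i) //= exprM subrX1 mulrC; apply: p_dvdMl => //.
  by apply: p_integral_sum => // k _; do 2 apply: p_integralX => //.
set d := `|denq a|%N; have d0 : (0 < d)%N by rewrite absz_gt0 denq_neq0.
have Dd : denq a = d :> int by rewrite absz_denq.
(* Any [d]-th root would serve: another one changes [w i] by a root of unity. *)
pose mu i := d.-root (lam i).
have muE i : mu i ^+ d = lam i by apply: rootCK.
have mu0 i : mu i != 0.
  by apply: contraNneq (l0 i) => e; rewrite -muE e expr0n gtn_eqF.
pose w i := mu i ^ numq a.
have wE i : w i ^+ d = lam i ^ numq a.
  by rewrite /w -muE !exprnP !exprz_exp mulrC.
have w0 i : w i != 0 by rewrite expfz_neq0.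
have wA i : p_integral p (w i).
  by apply: (p_integral_radical p_pr d0); rewrite wE; apply: p_integralXz.
have dN0 : (0 < d * N)%N by rewrite muln_gt0 d0.
have [z zL] := C_prim_root_exists dN0.
have [b b0 bA] := poly_common_denominator f.
have near j : exists k, (p_dvd p j (ratr (U (n k)))) /\ p_dvd p j (ratr ((n k)%:~R - a)).
  have [K1 H1] := U_lim j%:Z; have [K2 H2] := n_lim j%:Z.
  exists (maxn K1 K2); have := H1 (maxn K1 K2); have := H2 (maxn K1 K2).
  rewrite leq_maxl leq_maxr => /(_ isT) h2 /(_ isT) h1.
  by have [_ _ ?] := padic_valP p_pr h1; have [_ _ ?] := padic_valP p_pr h2.
(* With [j = 0], some [n k - a] is [p]-integral, hence so is [a]. *)
have aA : p_integral p (ratr a).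
  have [k [_ /p_dvd0]] := near 0%N; rewrite rmorphB /= ratr_int => h.
  rewrite -[ratr a](subKr (n k)%:~R); apply: p_integralD => //.
    exact/p_integral_Aint/Aint_int.
  exact: p_integralN.
pose q i := b%:R *: f i.
have qA i k : p_integral p (q i)`_k by apply: p_integral_Aint (bA i k).
have gA i x : p_integral p x -> p_integral p (q i).[x].
  move=> xA; rewrite horner_coef; apply: p_integral_sum => // k _.
  by apply: p_integralM => //; apply: p_integralX.
have [i|//|//|j|xi Hxi] := @twisted_sum_eq0 p p_pr s (d * N) z
    (fun i => (q i).[ratr a]) w zL.
- exact: gA.
- have [k [Uk ak]] := near j.
  have kA : p_integral p (n k)%:~R by apply/p_integral_Aint/Aint_int.
  have xA i : p_integral p (lam i ^ n k) by apply: p_integralXz.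
  exists (fun i => lam i ^ n k) => //; split=> [i|].
    (* [e] equals [d * (n k - a)], and [lam i ^ (N * e)] is the quotient of the two [d * N]-th
       powers to be compared. *)
    pose e := n k * denq a - numq a.
    have pe : (p ^ j %| `|e|)%N.
      apply: (p_dvd_int p_pr).
      have -> : e%:~R = d%:R * ratr ((n k)%:~R - a) :> algC.
        rewrite /e !rmorphB rmorphM /= mulrBr ratr_int ratr_denq.
        by rewrite Dd -pmulrn [_ * d%:R]mulrC.
      by apply: p_dvdMl => //; apply/p_integral_Aint/rpred_nat.
    have -> : (lam i ^ n k) ^+ (d * N) - w i ^+ (d * N) =
        (lam i ^ numq a) ^+ N * ((lam i ^+ N) ^ e - 1).
      rewrite mulrBr mulr1 [w i ^+ _]exprM wE; congr (_ - _).
      rewrite !exprnP !exprz_exp -expfzDr //; congr (_ ^ _).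
      by rewrite /e Dd PoszM; ring.
    apply: p_dvdMl => //; first by apply/p_integralX/p_integralXz.
    apply: (@p_dvd_leq p p_pr j j.+1) => //; apply: p_dvd_expzB1 => //.
    - exact: p_integralX.
    - by rewrite -exprVn; apply: p_integralX.
    - exact: expf_neq0.
  (* With [n k] in place of [a] inside the [q i], the sum would be [b%:R * ratr (U (n k))]; the
     error is controlled by [n k - a]. *)
  have -> : \sum_i (q i).[ratr a] * lam i ^ n k =
    b%:R * ratr (U (n k)) -
      \sum_i lam i ^ n k * ((q i).[(n k)%:~R] - (q i).[ratr a]).
    rewrite HU mulr_sumr -sumrB; apply: eq_bigr => i _.
    by rewrite !hornerZ; ring.
  apply: p_dvdB => //; first by apply: p_dvdMl => //; apply/p_integral_Aint/rpred_nat.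
  apply: p_dvd_sum => // i _; apply: p_dvdMl => //; apply: p_dvd_hornerB => //.
  by move: ak; rewrite rmorphB /= ratr_int.
exists w, (fun i => z ^+ xi i); split.
- by move=> i; exists (mu i) => //; rewrite Dd -exprnP muE.
- move=> i; exists (d * N)%N => //.
  by rewrite exprAC (prim_expr_order zL) expr1n.
apply: (mulfI (_ : b%:R != 0)); first by rewrite pnatr_eq0 -lt0n.
rewrite mulr0 mulr_sumr -[RHS]Hxi; apply: eq_bigr => i _.
by rewrite hornerZ; ring.
Qed.
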